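(* Suppose $f:[a,b]\to\mathbb{R}$ is a continuous $\Phi$-convex function. Then for any $n\in\mathbb{N}$, $$f\Big(\frac{a+b}{2}\Big)-E_n\leq\frac{1}{b-a}\mathcal{T}_{n}(f)\leq\frac{f(a)+f(b)}{2}+\frac{n^2-1}{6}\Phi\Big(\frac{b-a}{n}\Big),$$ where $$E_n=\begin{cases}\frac{n^2+2}{12}\Phi\left(\frac{b-a}{n}\right), & \text{if } n \text{ is even},\\[0.1cm] \frac{n^2-1}{12}\Phi\left(\frac{b-a}{n}\right)+\Phi\left(\frac{b-a}{2n}\right), & \text{if } n \text{ is odd}.\end{cases}$$
   Context: Let $a<b$ be real numbers. $\mathbb{N}$ denotes the set of positive integers and $\mathbb{R}_+$ the set of nonnegative reals. $\Phi:[0,b-a]\to\mathbb{R}_+$ is an arbitrary function (called the error function). A function $f:[a,b]\to\mathbb{R}$ is $\Phi$-convex if $$f(tx+(1-t)y)\leq tf(x)+(1-t)f(y)+t\Phi((1-t)|y-x|)+(1-t)\Phi(t|y-x|)$$ for all $x,y\in[a,b]$ and all $t\in[0,1]$. For $n\in\mathbb{N}$ put $x_i=a+\frac{(b-a)i}{n}$, $i=0,1,\ldots,n$. The Trapezoidal rule is $$\mathcal{T}_{n}(f)=\frac{b-a}{2n}\Big[f(x_0)+2\sum_{i=1}^{n-1}f(x_i)+f(x_n)\Big].$$ *)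

(* Defs.v *)
From mathcomp Require Import all_boot all_order all_algebra.
From mathcomp Require Import all_classical all_reals all_analysis.
Import Order.TTheory GRing.Theory Num.Theory.
Import numFieldNormedType.Exports.
Local Open Scope classical_set_scope.
Local Open Scope ring_scope.

Set Implicit Arguments.
Unset Strict Implicit.
Unset Printing Implicit Defensive.

(* Functions on [a, b] and on [0, b - a] are represented by total functions
   R -> R, of which only the values on the interval are constrained or used. *)

Definition error_function (R : realType) (a b : R) (Phi : R -> R) : Prop :=
  forall u : R, u \in `[0, b - a] -> 0 <= Phi u.

Definition phi_convex (R : realType) (a b : R) (Phi f : R -> R) : Prop :=
  forall x y t : R, x \in `[a, b] -> y \in `[a, b] -> t \in `[0, 1] ->
    f (t * x + (1 - t) * y) <=
      t * f x + (1 - t) * f y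
      + t * Phi ((1 - t) * `|y - x|) + (1 - t) * Phi (t * `|y - x|).

Definition node (R : realType) (a b : R) (n i : nat) : R :=
  a + (b - a) * i%:R / n%:R.

Definition trapezoidal (R : realType) (a b : R) (n : nat) (f : R -> R) : R :=
  (b - a) / (2 * n%:R) *
    (f (node a b n 0) + 2 * (\sum_(1 <= i < n) f (node a b n i))
     + f (node a b n n)).

Definition trapezoidal_error (R : realType) (a b : R) (Phi : R -> R) (n : nat)
    : R :=
  if odd n then
    (n%:R ^+ 2 - 1) / 12 * Phi ((b - a) / n%:R) + Phi ((b - a) / (2 * n%:R))
  else
    (n%:R ^+ 2 + 2) / 12 * Phi ((b - a) / n%:R).

(* Main.v *)
Require Import Defs.
From mathcomp Require Import all_boot all_order all_algebra.
From mathcomp Require Import all_classical all_reals all_analysis.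
From mathcomp Require Import zify ring lra.
Import Order.TTheory GRing.Theory Num.Theory.
Import numFieldNormedType.Exports.
Local Open Scope classical_set_scope.
Local Open Scope ring_scope.

(** Let u_i be the value of f at the i-th node, h = (b - a) / n and
    c = Phi h.  Phi-convexity enters only at t = 1/2: applied to two nodes at
    distance 2h it gives 2 u_i <= u_(i-1) + u_(i+1) + 2 c, so the second
    differences of u are at least -2c.  Those of i (n - i) are all equal to -2,
    hence v_i = u_i - c i (n - i) is a convex sequence, with the same end values
    as u.

    For a convex sequence v the sums s_i = v_i + v_(n-i) form a convex sequence
    symmetric about n/2, so s decreases up to n/2 and s_(n/2) <= s_i <= s_0
    ([convex_pair_bounds]).  Replacing i by n - i does not change the trapezoidal
    sum, so the sum of v is half that of s, which gives the Hermite-Hadamard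
    inequalities for v ([trap_sum_convex_bounds]).  Going back to u adds
    c times the sum of i (n - i), that is c n (n^2 - 1) / 6: this is the error
    term on the right.  On the left, s_(n/2) / 2 is u_(n/2) - c n^2 / 4 for even
    n, and for odd n it is the mean of the two central values of u minus
    c (n^2 - 1) / 4; one more use of t = 1/2, on the two central nodes, then
    brings in f at the midpoint and the additional term Phi (h / 2). *)

(** * Convex sequences *)

Definition convex_seq {R : realType} (n : nat) (v : nat -> R) : Prop :=
  forall i, (i.+2 <= n)%N -> 2 * v i.+1 <= v i + v i.+2.

Lemma convex_seq_increment {R : realType} (n : nat) (v : nat -> R) :
  convex_seq n v ->
  forall i j, (i <= j)%N -> (j < n)%N -> v i.+1 - v i <= v j.+1 - v j.
Proof.
move=> cv i j; elim: j => [|j IH] ij jn; first by have -> : i = 0%N by lia.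
have [->//|ne] := eqVneq i j.+1.
have {}IH : v i.+1 - v i <= v j.+1 - v j by apply: IH; lia.
by have := cv j jn; lra.
Qed.

(** The increment of s_i = v_i + v_(n-i) is a difference of two increments of v,
    the second one taken at n - i - 1, which is at least i when i < n/2. *)
Lemma convex_pair_nonincreasing {R : realType} (n : nat) (v : nat -> R) :
  convex_seq n v ->
  forall i j, (i <= j)%N -> (j <= n./2)%N ->
    v j + v (n - j)%N <= v i + v (n - i)%N.
Proof.
move=> cv i j; elim: j => [|j IH] ij jn; first by have -> : i = 0%N by lia.
have [->//|ne] := eqVneq i j.+1.
have {}IH : v j + v (n - j)%N <= v i + v (n - i)%N by apply: IH; lia.
have : v j.+1 - v j <= v (n - j.+1).+1 - v (n - j.+1)%N.
  by apply: (@convex_seq_increment _ n) => //; lia.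
have -> : ((n - j.+1).+1 = n - j)%N by lia.
by lra.
Qed.

Lemma convex_pair_bounds {R : realType} (n : nat) (v : nat -> R) :
  convex_seq n v -> forall i, (i <= n)%N ->
    v n./2 + v (n - n./2)%N <= v i + v (n - i)%N <= v 0%N + v n.
Proof.
move=> cv.
have left_half i : (i <= n./2)%N ->
    v n./2 + v (n - n./2)%N <= v i + v (n - i)%N <= v 0%N + v n.
  move=> ih; apply/andP; split; first exact: convex_pair_nonincreasing.
  by rewrite -[in leRHS](subn0 n); exact: convex_pair_nonincreasing.
move=> i le_in; have [/left_half//|ih] := leqP i n./2.
have -> : v i + v (n - i)%N = v (n - i)%N + v (n - (n - i))%N.
  by rewrite subKn // addrC.
by apply: left_half; lia.
Qed.

(** * Trapezoidal sums *)

Definition trap_sum {R : realType} (n : nat) (v : nat -> R) : R :=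
  v 0%N + 2 * (\sum_(1 <= i < n) v i) + v n.

Lemma trap_sumD {R : realType} (n : nat) (v w : nat -> R) :
  trap_sum n (fun i => v i + w i) = trap_sum n v + trap_sum n w.
Proof. by rewrite /trap_sum big_split /=; ring. Qed.

Lemma trap_sum_rev {R : realType} (n : nat) (v : nat -> R) :
  trap_sum n (fun i => v (n - i)%N) = trap_sum n v.
Proof.
rewrite /trap_sum subn0 subnn.
have -> : \sum_(1 <= i < n) v (n - i)%N = \sum_(1 <= i < n) v i.
  by rewrite [RHS]big_nat_rev; apply: eq_bigr => i _; congr v; lia.
by ring.
Qed.

Lemma trap_sum_const {R : realType} (n : nat) (c : R) :
  (0 < n)%N -> trap_sum n (fun=> c) = 2 * n%:R * c.
Proof.
case: n => // n _; rewrite /trap_sum sumr_const_nat subn1 /= -mulr_natl.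
by rewrite -(natr1 n); ring.
Qed.

Lemma ler_trap_sum {R : realType} (n : nat) (v w : nat -> R) :
  (forall i, (i <= n)%N -> v i <= w i) -> trap_sum n v <= trap_sum n w.
Proof.
move=> vw; have v0 := vw 0%N (leq0n n); have vn := vw n (leqnn n).
have : \sum_(1 <= i < n) v i <= \sum_(1 <= i < n) w i.
  by apply: ler_sum_nat => i /andP[_ /ltnW]; exact: vw.
by rewrite /trap_sum; lra.
Qed.

Lemma trap_sum_convex_bounds {R : realType} (n : nat) (v : nat -> R) :
  (0 < n)%N -> convex_seq n v ->
  n%:R * (v n./2 + v (n - n./2)%N) <= trap_sum n v <= n%:R * (v 0%N + v n).
Proof.
move=> n0 cv; have bnd := @convex_pair_bounds _ _ _ cv.
have sym : trap_sum n (fun i => v i + v (n - i)%N) = 2 * trap_sum n v.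
  by rewrite trap_sumD trap_sum_rev; ring.
have lo : trap_sum n (fun=> v n./2 + v (n - n./2)%N) <= 2 * trap_sum n v.
  by rewrite -sym; apply: ler_trap_sum => i /bnd/andP[].
have hi : 2 * trap_sum n v <= trap_sum n (fun=> v 0%N + v n).
  by rewrite -sym; apply: ler_trap_sum => i /bnd/andP[].
by move: lo hi; rewrite !trap_sum_const //; lra.
Qed.

Lemma sum_parabola {R : realType} (n k : nat) :
  \sum_(0 <= i < k) (i%:R * (n%:R - i%:R)) =
    k%:R * (k%:R - 1) * (3 * n%:R - 2 * k%:R + 1) / 6 :> R.
Proof.
elim: k => [|k IH]; first by rewrite big_geq // !mul0r.
by rewrite big_nat_recr //= IH -(natr1 k); field.
Qed.

Lemma trap_sum_parabola {R : realType} (n : nat) (c : R) : (0 < n)%N ->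
  trap_sum n (fun i => c * (i%:R * (n%:R - i%:R))) =
    c * n%:R * (n%:R ^+ 2 - 1) / 3.
Proof.
move=> n0; have := @sum_parabola R n n; rewrite big_ltn // /trap_sum -mulr_sumr.
by rewrite mul0r add0r => ->; field.
Qed.

(** Hermite-Hadamard for sequences whose second differences are at least
    -2c: subtracting c i (n - i), which vanishes at both ends, makes the
    sequence convex. *)
Lemma trap_sum_almost_convex_bounds {R : realType} (n : nat) (u : nat -> R)
    (c : R) : (0 < n)%N ->
  (forall i, (i.+2 <= n)%N -> 2 * u i.+1 <= u i + u i.+2 + 2 * c) ->
  n%:R * (u n./2 + u (n - n./2)%N
          - 2 * c * (n./2%:R * (n%:R - n./2%:R)) + c * (n%:R ^+ 2 - 1) / 3)
    <= trap_sum n u <= n%:R * (u 0%N + u n + c * (n%:R ^+ 2 - 1) / 3).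
Proof.
move=> n0 cu.
pose p i : R := c * (i%:R * (n%:R - i%:R)); pose v i := u i - p i.
have cv : convex_seq n v.
  move=> i /cu; rewrite /v /p -(natr1 i.+1) -(natr1 i).
  move: (u i) (u i.+1) (u i.+2) => u0 u1 u2 ?.
  rewrite -subr_ge0.
  have -> : u0 - c * (i%:R * (n%:R - i%:R)) +
      (u2 - c * ((i%:R + 1 + 1) * (n%:R - (i%:R + 1 + 1)))) -
      2 * (u1 - c * ((i%:R + 1) * (n%:R - (i%:R + 1)))) =
    u0 + u2 + 2 * c - 2 * u1 by ring.
  by lra.
have -> : trap_sum n u = trap_sum n v + c * n%:R * (n%:R ^+ 2 - 1) / 3.
  rewrite -trap_sum_parabola // -trap_sumD /trap_sum /v /p !subrK.
  by congr (_ + 2 * _ + _); apply: eq_bigr => i _; rewrite subrK.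
have := @trap_sum_convex_bounds _ _ _ n0 cv.
have -> : n%:R * (v n./2 + v (n - n./2)%N) =
    n%:R * (u n./2 + u (n - n./2)%N - 2 * c * (n./2%:R * (n%:R - n./2%:R))).
  by rewrite /v /p natrB; [ring|lia].
have -> : v 0%N + v n = u 0%N + u n by rewrite /v /p; ring.
move=> /andP[lo hi]; apply/andP; split.
- by rewrite mulrDr; lra.
- by rewrite mulrDr; lra.
Qed.

(** * Phi-convex functions on the nodes *)

Lemma phi_convex_midpoint {R : realType} (a b : R) (Phi f : R -> R) (x y : R) :
  phi_convex a b Phi f -> x \in `[a, b] -> y \in `[a, b] -> x <= y ->
  2 * f ((x + y) / 2) <= f x + f y + 2 * Phi ((y - x) / 2).
Proof.
move=> cf xab yab xy.
have half_in : (1 / 2 : R) \in `[0, 1] by rewrite in_itv /=; lra.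
have := cf x y (1 / 2) xab yab half_in.
rewrite ger0_norm ?subr_ge0 //.
have -> : 1 / 2 * x + (1 - 1 / 2) * y = (x + y) / 2 by field.
have -> : (1 - 1 / 2) * (y - x) = (y - x) / 2 by field.
have -> : 1 / 2 * (y - x) = (y - x) / 2 by field.
by lra.
Qed.

Lemma node_in {R : realType} (a b : R) (n i : nat) :
  a < b -> (0 < n)%N -> (i <= n)%N -> node a b n i \in `[a, b].
Proof.
move=> ab n0 le_in; rewrite in_itv /= /node -mulrA.
have r0 : 0 <= i%:R / n%:R :> R by rewrite divr_ge0.
have r1 : i%:R / n%:R <= 1 :> R by rewrite ler_pdivrMr ?ltr0n // mul1r ler_nat.
by apply/andP; split; nra.
Qed.

Lemma le_node {R : realType} (a b : R) (n i j : nat) :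
  a < b -> (i <= j)%N -> node a b n i <= node a b n j.
Proof.
move=> ab ij; rewrite /node lerD2l ler_wpM2r ?invr_ge0 //.
by rewrite ler_wpM2l ?ler_nat // subr_ge0 ltW.
Qed.

Theorem theorem4 (R : realType) (a b : R) (Phi f : R -> R)
    (hab : a < b)
    (hPhi : error_function a b Phi)
    (hcont : {within `[a, b], continuous f})
    (hconv : phi_convex a b Phi f)
    (n : nat) (hn : (0 < n)%N) :
  f ((a + b) / 2) - trapezoidal_error a b Phi n
    <= (b - a)^-1 * trapezoidal a b n f
  /\
  (b - a)^-1 * trapezoidal a b n f
    <= (f a + f b) / 2 + (n%:R ^+ 2 - 1) / 6 * Phi ((b - a) / n%:R).
Proof.
have nR : n%:R != 0 :> R by rewrite pnatr_eq0 -lt0n.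
have baR : b - a != 0 by rewrite subr_eq0 gt_eqF.
pose u i := f (node a b n i); pose c := Phi ((b - a) / n%:R).
have mid i j : (i <= j)%N -> (j <= n)%N ->
    2 * f ((node a b n i + node a b n j) / 2) <=
      u i + u j + 2 * Phi ((node a b n j - node a b n i) / 2).
  move=> ij jn; apply: (@phi_convex_midpoint _ a b) => //.
  - by apply: node_in => //; lia.
  - exact: node_in.
  - exact: le_node.
have cu i : (i.+2 <= n)%N -> 2 * u i.+1 <= u i + u i.+2 + 2 * c.
  move=> le_in; have := mid i i.+2 (leq_trans (leqnSn _) (leqnSn _)) le_in.
  have -> : (node a b n i + node a b n i.+2) / 2 = node a b n i.+1.
    by rewrite /node -(natr1 i.+1) -(natr1 i); field.
  have -> // : (node a b n i.+2 - node a b n i) / 2 = (b - a) / n%:R.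
  by rewrite /node -(natr1 i.+1) -(natr1 i); field.
have meanE : (b - a)^-1 * trapezoidal a b n f = trap_sum n u / (2 * n%:R).
  by rewrite /trapezoidal -/(trap_sum n u); field; rewrite nR baR.
have n2 : 0 < 2 * n%:R :> R by rewrite mulr_gt0 // ltr0n.
have := @trap_sum_almost_convex_bounds _ _ u _ hn cu.
rewrite meanE => /andP[lo hi]; split; last first.
  have u0 : u 0%N = f a by rewrite /u /node mulr0 mul0r addr0.
  have un : u n = f b by rewrite /u /node; congr f; field.
  rewrite ler_pdivrMr // -u0 -un -/c; apply: le_trans hi _.
  by rewrite le_eqVlt; apply/orP; left; apply/eqP; field.
rewrite ler_pdivlMr //; apply: le_trans lo.
rewrite [leRHS](_ : _ = ((u n./2 + u (n - n./2)%N) / 2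
    - c * (n./2%:R * (n%:R - n./2%:R)) + c * (n%:R ^+ 2 - 1) / 6)
    * (2 * n%:R)); last by field.
rewrite ler_pM2r //.
have le_half : (n./2 <= n - n./2)%N by lia.
have := mid _ _ le_half (leq_subr _ _).
have -> : (node a b n n./2 + node a b n (n - n./2)) / 2 = (a + b) / 2.
  by rewrite /node natrB; [field|lia].
rewrite /trapezoidal_error -/c.
have : n%:R = (odd n)%:R + 2 * n./2%:R :> R.
  by rewrite -natrM -natrD mul2n odd_double_half.
case: ifP => odd_n /= nE.
- have -> : (node a b n (n - n./2) - node a b n n./2) / 2 = (b - a) / (2 * n%:R).
    have -> : (n - n./2 = n./2.+1)%N by lia.
    by rewrite /node -(natr1 n./2); field.
  have -> : n./2%:R = (n%:R - 1) / 2 :> R by rewrite nE; field.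
  by lra.
(* For even n both central indices are n/2: the midpoint is itself a node and
   the midpoint inequality carries no information. *)
- have hK : (n - n./2 = n./2)%N by lia.
  have midE : u n./2 = f ((a + b) / 2).
    rewrite /u /node; congr f.
    have -> : n./2%:R = n%:R / 2 :> R by rewrite nE; field.
    by field.
  rewrite hK -midE => _.
  have -> : n./2%:R = n%:R / 2 :> R by rewrite nE; field.
  by lra.
Qed.
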